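(* Let $p_1,p_2,\ldots$ be an enumeration of the primes. Let $\alpha=1$ and, for each $n\geq2$, let $d_{n,1}=\prod_{t=1}^n\frac{1}{p_t^n}$. Then System $( * )$ is strongly centrally partition regular over $\mathbb Q$, but is not partition regular over $\mathbb G_F$ for any proper subset $F$ of the set $P$ of all primes.
   Context: For a set $F$ of primes, $\mathbb G_F=\{a/b: a\in\mathbb Z,\ b\in\mathbb N,\ \text{all prime factors of } b \text{ lie in } F\}$. System $( * )$ with $\alpha=1$ is the infinite system of linear equations in unknowns $y_1$, $x_{n,j}$, $z_n$ ($n\geq2$, $1\leq j\leq n$) consisting of, for every $n\geq2$, the equation $x_{n,1}+\cdots+x_{n,n}+d_{n,1}y_1=z_n$. A system is partition regular over a set $S\subseteq\mathbb R$ if, whenever $S\setminus\{0\}$ is finitely coloured, there is a solution with all variables in one colour class. For a commutative semigroup $(S,+)$ with the discrete topology, $\beta S$ is the Stone–Čech compactification, whose points are the ultrafilters on $S$. The operation extends to $\beta S$ by: $A\in p+q$ iff $\{x\in S:-x+A\in q\}\in p$, where $-x+A=\{y\in S:x+y\in A\}$; $\beta S$ is then a compact right topological semigroup with smallest two-sided ideal $K(\beta S)$, and idempotents in $K(\beta S)$ are minimal idempotents. $A\subseteq S$ is central if it belongs to some minimal idempotent. A system is strongly centrally partition regular over $S$ if whenever $C$ is a central subset of $S$, there is a solution with all variables taking values in $C$ and distinct variables taking different values. *)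

(* Defs.v *)
From HB Require Import structures.
From mathcomp Require Import all_boot all_order all_algebra.
From mathcomp Require Import boolp classical_sets functions filter.

Set Implicit Arguments.
Unset Strict Implicit.
Unset Printing Implicit Defensive.

Import GRing.Theory.

Local Open Scope classical_set_scope.
Local Open Scope ring_scope.

(* The points of the Stone-Cech compactification of the discrete space S.  No
   definition below refers to its topology. *)
Record betaS (S : Type) := BetaS {
  betaS_sets :> set S -> Prop;
  betaS_ultra : UltraFilter betaS_sets
}.

Section BetaSemigroup.
(* In MathComp the addition of an addSemigroupType is commutative. *)
Variable S : addSemigroupType.
Implicit Types (p q : betaS S) (A : set S) (I : set (betaS S)).

Definition beta_add_sets p q : set_system S :=
  [set A | p [set x | q [set y | A (x + y)]]].

Lemma beta_add_ultra p q : UltraFilter (beta_add_sets p q).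
Proof.
have pU := betaS_ultra p; have qU := betaS_ultra q.
have pqP : ProperFilter (beta_add_sets p q).
  split.
    rewrite /beta_add_sets /= => pq0; apply: (@filter_not_empty _ p _).
    by apply: (@filterS _ p _ _ _ _ pq0) => x /= /filter_not_empty.
  split.
  - by apply: (@filterE _ p) => x; apply: (@filterE _ q).
  - move=> A B; rewrite /beta_add_sets /= => pA pB.
    by apply: filterS2 pA pB => x /= qA qB; apply: filterS2 qA qB.
  - move=> A B AB; rewrite /beta_add_sets /=; apply: filterS => x /=.
    by apply: filterS => y /=; apply: AB.
split=> // G GP subG; apply/seteqP; split=> // A GA.
have [//|pNA] := in_ultra_setVsetC [set x | q [set y | A (x + y)]] pU.
exfalso; apply: (@filter_not_empty _ G _).
rewrite -(setICr A); apply: filterI => //; apply: subG.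
rewrite /beta_add_sets /=; apply: filterS pNA => x /= nqA.
by have [/nqA|] := in_ultra_setVsetC [set y | A (x + y)] qU.
Qed.

Definition beta_add p q : betaS S := BetaS (beta_add_ultra p q).

Definition two_sided_ideal I : Prop :=
  I !=set0 /\ forall p q, I p -> I (beta_add p q) /\ I (beta_add q p).

(* K(betaS), as the intersection of all two-sided ideals *)
Definition beta_K : set (betaS S) := smallest two_sided_ideal set0.

Definition minimal_idempotent p : Prop := beta_K p /\ beta_add p p = p.

Definition central A : Prop := exists2 p, minimal_idempotent p & p A.

End BetaSemigroup.

(* A system of equations in unknowns indexed by V, with values in R, is given
   by its set of solutions. *)
Definition partition_regular (V : Type) (R : nmodType)
    (system : set (V -> R)) (S : set R) : Prop :=
  forall (k : nat) (c : S `\ 0 -> 'I_k),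
    exists (i : 'I_k) (f : V -> S `\ 0),
      system (fun v => val (f v)) /\ forall v, c (f v) = i.

Definition strongly_centrally_partition_regular (V : Type)
    (S : addSemigroupType) (system : set (V -> S)) : Prop :=
  forall C : set S, central C ->
    exists f : V -> S, [/\ system f, forall v, C (f v) & injective f].

(* The indices j of x_{n,j} are shifted: j : 'I_n stands for j + 1. *)
Inductive unknown : Type :=
  | Y1
  | X (n : nat) of (2 <= n)%N & 'I_n
  | Z (n : nat) of (2 <= n)%N.

Definition star_system (d : nat -> rat) : set (unknown -> rat) :=
  [set f | forall (n : nat) (n_ge2 : (2 <= n)%N),
    \sum_(j < n) f (X n_ge2 j) + d n * f Y1 = f (Z n_ge2)].

Definition GG (F : set nat) : set rat :=
  [set x | exists (a : int) (b : nat),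
    [/\ (0 < b)%N, forall q, prime q -> (q %| b)%N -> F q
      & x = a%:~R / b%:R]].

Definition primes_set : set nat := [set q | prime q].

(* p 1, p 2, ... enumerates the primes; p 0 is irrelevant. *)
Definition prime_enumeration (p : nat -> nat) : Prop :=
  set_bij [set t | (0 < t)%N] primes_set p.

Definition prime_power_coef (p : nat -> nat) (n : nat) : rat :=
  \prod_(1 <= t < n.+1) ((p t)%:R ^+ n)^-1.

(* Main.v *)
(** Let [D] belong to a minimal idempotent [p].  Then [D] is piecewise
    syndetic, so among sufficiently many distinct rationals some difference is
    attained by infinitely many pairs of elements of [D].  Hence the set of
    such differences is syndetic and, as the divisible group [Q] has no proper
    subgroup of finite index, there is an [N] such that for [n >= N] every
    rational is of the form [z - (x_1 + ... + x_n)] with [x_j, z] in [D], in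
    infinitely many disjoint ways.  For each [n < N], idempotence of [p] shows
    that the [y] for which [d_n y] is of this form make up a member of [p].
    So a single [y] in [D] serves all the equations, which are then solved one
    after the other, whatever the coefficients [d_n] are.

    If a prime [q] is not in [F], the elements of [G_F] have no [q] in the
    denominator, whereas [q] divides the denominator of [d_n y] for [n] large
    enough (unless [y = 0]); so the system has no solution in [G_F \ {0}]. *)

Require Import Defs.
From mathcomp Require Import all_boot all_order all_algebra.
From mathcomp Require Import boolp classical_sets functions filter.
From mathcomp Require Import ring.

Set Implicit Arguments.
Unset Strict Implicit.
Unset Printing Implicit Defensive.

Import Order.TTheory GRing.Theory Num.Theory.

Local Open Scope classical_set_scope.
Local Open Scope ring_scope.

(** * Piecewise syndetic sets and the members of minimal ultrafilters *)

Section PiecewiseSyndetic.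
Variable V : zmodType.
Implicit Types (A B T : set V) (E G H : seq V).

Definition thick T := forall G, exists x, forall g, g \in G -> T (x + g).

Definition piecewise_syndetic A :=
  exists E, thick [set x | exists2 e, e \in E & A (x + e)].

Lemma thickS A B : A `<=` B -> thick A -> thick B.
Proof. by move=> AB tA G; have [x xA] := tA G; exists x => g /xA /AB. Qed.

(** If no translate of [G] lies in [A], then every translate of [G] inside the union meets [B];
    applying thickness to [H + G] shows that [G] serves as the list of shifts for [B]. *)
Lemma thick_setU A B : thick (A `|` B) -> thick A \/ piecewise_syndetic B.
Proof.
move=> tAB; have [|ntA] := pselect (thick A); first by left.
right; move/existsNP: ntA => [G /forallNP GA].
exists G => H; have [x xAB] := tAB [seq h + g | h <- H, g <- G].
exists x => h hH; have /existsNP[g /not_implyP[gG nA]] := GA (x + h).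
exists g => //.
have := xAB (h + g) (allpairs_f _ hH gG).
by rewrite addrA => -[].
Qed.

Lemma piecewise_syndeticS A B :
  A `<=` B -> piecewise_syndetic A -> piecewise_syndetic B.
Proof.
move=> AB [E tA]; exists E; apply: thickS tA => x [e eE /AB Be].
by exists e.
Qed.

Lemma piecewise_syndeticT : piecewise_syndetic setT.
Proof. by exists [:: 0] => G; exists 0 => g _; exists 0; rewrite ?inE. Qed.

Lemma piecewise_syndetic0 : ~ piecewise_syndetic set0.
Proof. by case=> E /(_ [:: 0])[x /(_ 0 (mem_head _ _))[]]. Qed.

Lemma piecewise_syndetic_setU A B : piecewise_syndetic (A `|` B) ->
  piecewise_syndetic A \/ piecewise_syndetic B.
Proof.
case=> E tAB; pose translates C := [set x | exists2 e, e \in E & C (x + e)].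
have /thick_setU[tA|[E' tB]] : thick (translates A `|` translates B).
- by apply: thickS tAB => x [e eE [Ae|Be]]; [left|right]; exists e.
- by left; exists E.
right; exists [seq e' + e | e' <- E', e <- E].
apply: thickS tB => x [e' e'E [e eE]]; rewrite -addrA => Be.
by exists (e' + e) => //; apply: allpairs_f.
Qed.

Lemma piecewise_syndetic_shift A x :
  piecewise_syndetic [set y | A (x + y)] -> piecewise_syndetic A.
Proof.
case=> E tA; exists E => G; have [y yA] := tA G.
exists (x + y) => g /yA[e eE Ae]; exists e => //.
by move: Ae; rewrite /= !addrA.
Qed.

(** By [piecewise_syndetic_setU] the sets whose complement is not piecewise syndetic form a proper
    filter; any ultrafilter extending it will do. *)
Lemma ultra_piecewise_syndetic :
  exists q : betaS V, forall A, q A -> piecewise_syndetic A.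
Proof.
pose F : set_system V := [set A | ~ piecewise_syndetic (~` A)].
have FP : ProperFilter F.
  split; first by rewrite /F /= setC0 => /(_ piecewise_syndeticT).
  split; rewrite /F /=.
  - by rewrite setCT; apply: piecewise_syndetic0.
  - by move=> A B /= nA nB; rewrite setCI => /piecewise_syndetic_setU[].
  - move=> A B AB /= nA nB; apply: nA.
    by apply: piecewise_syndeticS nB; apply: subsetC.
have [G [GU FG]] := ultraFilterLemma FP.
exists (BetaS GU) => A /= GA; apply: contrapT => nA.
apply: (@filter_not_empty _ G _); rewrite -(setICr A).
by apply: filterI => //; apply: FG; rewrite /F /= setCK.
Qed.

Lemma beta_K_piecewise_syndetic (p : betaS V) A :
  beta_K p -> p A -> piecewise_syndetic A.
Proof.
(* The ultrafilters all of whose members are piecewise syndetic form a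
   two-sided ideal. *)
move=> Kp; move: A.
apply: (Kp [set q : betaS V | forall A, q A -> piecewise_syndetic A]).
split=> //; split; first exact: ultra_piecewise_syndetic.
move=> q r qPS; have rU := betaS_ultra r; have qU := betaS_ultra q; split=> A.
- move=> /qPS[E tB]; exists E => G; have [x xB] := tB G.
  (* Finitely many members of [r] have a common point, so one [y] serves all [g] in [G]. *)
  have : r [set y | forall g, g \in G -> exists2 e, e \in E & A (x + g + e + y)].
    elim: G {tB} xB => [|g G IH] xB; first by apply: filterE.
    have [e eE re] := xB g (mem_head _ _).
    have /IH : forall h, h \in G ->
        exists2 e, e \in E & r [set y | A (x + h + e + y)].
      by move=> h hG; apply: xB; rewrite inE hG orbT.
    apply: filterS2 re => y /= Ay yG h.
    by rewrite inE => /predU1P[->|/yG//]; exists e.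
  move=> /(filter_ex)[y yA]; exists (x + y) => g /yA[e eE Ae]; exists e => //.
  by rewrite -!addrA (addrC y) !addrA.
- move=> rqA; have /filter_ex[x] : r [set x | q [set y | A (x + y)]] by [].
  by move=> /qPS/piecewise_syndetic_shift.
Qed.

End PiecewiseSyndetic.

(** * Members of idempotents and sums over intervals *)

(** A finite form of Hindman's theorem: [W] lists partial sums, and the sums of consecutive
    increments lie in [B]. An increment [x] in [B] with [-x + B] in [p] is put in front of a
    sequence for the intersection of [B] and [-x + B]. *)
Lemma idempotent_intervals (V : zmodType) (p : betaS V) (B : set V) (m : nat) :
  beta_add p p = p -> p B ->
  exists W : nat -> V, forall j i, (j < i <= m)%N -> B (W i - W j).
Proof.
move=> pp; have pU := betaS_ultra p.
elim: m B => [|m IH] B pB.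
  by exists (fun=> 0) => j i /andP[ji]; rewrite leqNgt (leq_trans _ ji).
have : p [set x | p [set y | B (x + y)]].
  by have : beta_add p p B by rewrite pp.
move=> /(filterI pB)/filter_ex[x [Bx pBx]].
have [W WP] := IH _ (filterI pB pBx).
exists (fun i => if i is i'.+1 then x + (W i' - W 0%N) else 0) => j [//|i].
case: j => [|j] /andP[ji im].
  rewrite subr0; case: i im {ji} => [_|i im]; first by rewrite subrr addr0.
  by have [] := WP 0%N i.+1 im.
have [] := WP j i; first by rewrite -ltnS ji.
by rewrite (addrC x) opprD addrA addrK opprB addrA subrK.
Qed.

(** * Differences attained infinitely often *)

Lemma thick_avoid (T : set rat) (G Bad : seq rat) : thick T ->
  exists2 x, x \notin Bad & forall g, g \in G -> T (x + g).
Proof.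
pose W : seq rat := [seq i%:R | i <- iota 0 (size Bad).+1].
have Wu : uniq W by rewrite map_inj_uniq ?iota_uniq //; apply: mulrIn.
move=> /(_ [seq w + g | w <- W, g <- G])[y yT].
have [w wW ywB] : exists2 w, w \in W & y + w \notin Bad.
  apply: contrapT => /forall2NP nW.
  have /uniq_leq_size yW_size : uniq (map (+%R y) W).
    by rewrite map_inj_uniq //; apply: addrI.
  have /yW_size : {subset map (+%R y) W <= Bad}.
    by move=> _ /mapP[w wW ->]; have [//|/negP/negPn] := nW w.
  by rewrite !size_map size_iota ltnn.
by exists (y + w) => // g gG; rewrite -addrA; apply: yT; apply: allpairs_f.
Qed.

(** Avoiding every finite [G] encodes infinitely many pairs, in the form needed to choose distinct
    values successively. *)
Definition returns (D : set rat) : set rat := [set s | s != 0 /\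
  forall G : seq rat, exists b, [/\ D b, D (b + s), b \notin G & b + s \notin G]].

(** For a suitable [y], each of the [size E + 1] points [y + w k] is moved into [D] by a shift from
    [E]; two of them share a shift, so their difference is one of elements of [D]. *)
Lemma returns_pigeonhole (D : set rat) : piecewise_syndetic D ->
  exists r, forall w : nat -> rat,
    (forall j i, (j < i <= r)%N -> w i != w j) ->
    exists j i, (j < i <= r)%N /\ returns D (w i - w j).
Proof.
case=> E tD; exists (size E) => w w_neq; apply: contrapT => noret.
set r := size E in w_neq noret.
have /choice[Gf GfP] (ji : nat * nat) : exists G : seq rat,
    (ji.1 < ji.2 <= r)%N -> forall b, D b -> D (b + (w ji.2 - w ji.1)) ->
    (b \in G) || (b + (w ji.2 - w ji.1) \in G).
  have [ji_r|] := boolP (ji.1 < ji.2 <= r)%N; last by exists [::].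
  apply: contrapT => /forallNP H; apply: noret; exists ji.1, ji.2; split=> //.
  split; first by rewrite subr_eq0 w_neq.
  move=> G; apply: contrapT => /forallNP nb; apply: (H G) => _ b Db Dbs.
  by apply: contrapT => /negP; rewrite negb_or => /andP[bG bsG]; apply: (nb b).
pose idx := iota 0 r.+1; have idxE k : (k \in idx) = (k <= r)%N.
  by rewrite mem_iota add0n ltnS.
pose GG := flatten [seq Gf (j, i) | j <- idx, i <- idx].
(* The [y] for which some [y + w k + e] would fall into one of the lists [Gf]. *)
pose Bad := [seq g - v | g <- GG, v <- [seq w k + e | k <- idx, e <- E]].
have [y yBad yD] := thick_avoid [seq w k | k <- idx] Bad tD.
have /choice[ef efP] k : exists e, k \in idx -> e \in E /\ D (y + w k + e).
  have [kr|] := boolP (k \in idx); last by exists 0.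
  by have [|e eE De] := yD (w k); [rewrite map_f|exists e].
have avoid j i k : j \in idx -> i \in idx -> k \in idx ->
    y + w k + ef k \notin Gf (j, i).
  move=> jr ir kr; apply/negP => yG; move/negP: yBad; apply.
  apply/allpairsP; exists (y + w k + ef k, w k + ef k); split.
  - by apply/flattenP; exists (Gf (j, i)) => //; apply: (allpairs_f (fun j i => Gf (j, i))).
  - by apply: (allpairs_f (fun k e => w k + e)) => //; case: (efP k kr).
  - by rewrite /= -(addrA y) addrK.
have : ~~ uniq [seq ef k | k <- idx].
  apply/negP => /uniq_leq_size ef_size.
  have /ef_size : {subset [seq ef k | k <- idx] <= E}.
    by move=> _ /mapP[k kr ->]; case: (efP k kr).
  by rewrite size_map size_iota ltnn.
move=> /(uniqPn 0)[j [i [ji]]]; rewrite size_map size_iota => ir.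
have jr := ltn_trans ji ir.
rewrite !(nth_map 0%N) ?size_iota// !nth_iota// !add0n => efij.
have [jI iI] : j \in idx /\ i \in idx by rewrite !idxE -ltnS jr -ltnS ir.
have [_ Dj] := efP j jI; have [_ Di] := efP i iI.
have yE : y + w j + ef j + (w i - w j) = y + w i + ef i by rewrite efij; ring.
have := GfP (j, i) _ (y + w j + ef j) Dj; rewrite /= yE ji /= -ltnS ir.
move=> /(_ erefl Di); rewrite (negPf (avoid j i j jI iI jI)).
by rewrite (negPf (avoid j i i jI iI iI)).
Qed.

Lemma returns_neq0 (D : set rat) : piecewise_syndetic D -> exists s, returns D s.
Proof.
move=> /returns_pigeonhole[r /(_ (fun i => i%:R))[j i|j [i [_ ret]]]]; last first.
  by exists (i%:R - j%:R).
by move=> /andP[ji _]; rewrite eqr_nat gtn_eqF.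
Qed.

(** Otherwise one could choose successively distinct rationals none of whose differences is in
    [returns D], against the pigeonhole lemma. *)
Lemma returns_syndetic (D : set rat) : piecewise_syndetic D ->
  exists E : seq rat, forall q, exists2 e, e \in E & returns D (q + e).
Proof.
move=> psD; have [s0 rs0] := returns_neq0 psD.
(* The value 0 is never a return; where it occurs, the extra shift by [s0] repairs it. *)
suff [E EP] : exists E : seq rat, forall q, exists2 e, e \in E &
    returns D (q + e) \/ q + e = 0.
  exists (E ++ [seq e + s0 | e <- E]) => q; have [e eE [ret|q0]] := EP q.
    by exists e; rewrite ?mem_cat ?eE.
  exists (e + s0); first by rewrite mem_cat (map_f (+%R^~ s0)) ?orbT.
  by rewrite addrA q0 add0r.
apply: contrapT => /forallNP noE.
have /choice[g gP] (E : seq rat) : exists q, forall e, e \in E ->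
    ~ (returns D (q + e) \/ q + e = 0).
  have /existsNP[q /forall2NP qP] := noE E; exists q => e eE.
  by have [/(_ eE)|] := qP e.
pose l := fix l k := if k is k'.+1 then - g (l k') :: l k' else [::].
have l_mem j i : (j < i)%N -> - g (l j) \in l i.
  elim: i => // i IH; rewrite ltnS leq_eqVlt => /predU1P[->|/IH ji].
    exact: mem_head.
  by rewrite inE ji orbT.
have [r /(_ (fun k => g (l k)))[]] := returns_pigeonhole psD.
  move=> j i /andP[/l_mem ji _]; apply/eqP => gij.
  by apply: (gP _ _ ji); right; rewrite gij subrr.
by move=> j [i [/andP[/l_mem ji _] ret]]; apply: (gP _ _ ji); left.
Qed.

(** * Solving a single equation by values not yet used *)

Definition fresh (D : set rat) (G xs : seq rat) :=
  uniq xs /\ forall x, x \in xs -> D x /\ x \notin G.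

Lemma fresh_nil D G : fresh D G [::].
Proof. by split. Qed.

Lemma fresh_cons (D : set rat) G x xs :
  D x -> x \notin G -> fresh D (x :: G) xs -> fresh D G (x :: xs).
Proof.
move=> Dx xG [xsu xsP]; split=> /= [|z].
  by rewrite xsu andbT; apply/negP => /xsP[_]; rewrite mem_head.
rewrite inE => /predU1P[->//|/xsP[Dz]].
by rewrite inE negb_or => /andP[].
Qed.

Lemma freshS D D' G G' xs :
  D' `<=` D -> {subset G <= G'} -> fresh D' G' xs -> fresh D G xs.
Proof.
move=> DD GG [xsu xsP]; split=> // x /xsP[/DD Dx xG']; split=> //.
by apply: contra xG' => /GG.
Qed.

Lemma returns_fresh D G s xs : returns D s -> fresh D G xs ->
  exists z x, fresh D G (z :: x :: xs) /\ z = x + s.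
Proof.
move=> [s_neq0 /(_ (G ++ xs))[x [Dx Dxs]]]; rewrite !mem_cat !negb_or.
move=> /andP[xG xxs] /andP[zG zxs] [xsu xsP]; exists (x + s), x; split=> //.
split=> /= [|y].
  rewrite inE negb_or zxs xxs xsu !andbT.
  by rewrite -subr_eq0 addrC addKr.
by rewrite !inE => /or3P[/eqP->|/eqP->|/xsP].
Qed.

(** Here [t] stands for the term [d n * y] of the [n]-th equation, and [G] for the values already
    taken. *)
Definition solvable_diff (D : set rat) (n : nat) : set rat := [set t |
  forall G : seq rat, exists z xs, [/\ size xs = n, fresh D G (z :: xs)
    & \sum_(x <- xs) x + t = z]].

Section Idempotent.
Variables (p : betaS rat).
Hypothesis p_ps : forall A, p A -> piecewise_syndetic A.
Hypothesis p_idem : beta_add p p = p.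

(** A finite set has no returns, hence is not piecewise syndetic. *)
Lemma ultra_avoid (G : seq rat) : p [set x | x \notin G].
Proof.
have [|pG] := in_ultra_setVsetC [set x | x \notin G] (betaS_ultra p); first by [].
have [s [_ /(_ G)[b [nbG _ bG _]]]] := returns_neq0 (p_ps pG).
by exfalso; apply: nbG.
Qed.

(* [V] is used to keep the values [W i + V i] distinct, as required in
   [returns_pigeonhole]. *)
Lemma idempotent_fresh_sums (D : set rat) (m r : nat) (G : seq rat) (V : nat -> rat) :
  p D -> exists W : nat -> rat, forall j i, (j < i <= r)%N ->
    W i + V i != W j + V j /\
    exists xs, [/\ size xs = m.+1, fresh D G xs & \sum_(x <- xs) x = W i - W j].
Proof.
move=> pD; have pU := betaS_ultra p; pose idx := iota 0 r.+1.
have idxP j i : (j < i <= r)%N -> j \in idx /\ i \in idx.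
  move=> /andP[ji ir]; rewrite !mem_iota !add0n !ltnS; split=> //.
  exact: leq_trans (ltnW ji) ir.
elim: m G V => [|m IH] G V.
  (* [W i + V i = W j + V j] would make [W i - W j] equal to [V j - V i]. *)
  pose G' := G ++ [seq V j - V i | i <- idx, j <- idx].
  have [W WP] := idempotent_intervals r p_idem (filterI pD (ultra_avoid G')).
  exists W => j i /[dup] ji /WP[DW]; have [jI iI] := idxP j i ji.
  rewrite /= mem_cat negb_or => /andP[WG WV]; split.
    apply: contra WV => /eqP Wij; apply/allpairsP; exists (i, j); split=> //=.
    by rewrite (_ : W i = W j + V j - V i); [ring|rewrite -Wij addrK].
  exists [:: W i - W j]; split; rewrite ?big_seq1//.
  exact/fresh_cons/fresh_nil.
have [U UP] := idempotent_intervals r p_idem (filterI pD (ultra_avoid G)).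
(* Each [U i - U j] becomes one more summand, so the others must avoid it. *)
have [W WP] := IH (G ++ [seq U i - U j | i <- idx, j <- idx]) (fun k => U k + V k).
exists (fun k => U k + W k) => j i /[dup] ji /[dup] /WP[neq [xs [xs_size xsP xsE]]].
move=> /UP[/= DU UG]; have [jI iI] := idxP j i ji; split.
  by rewrite !(addrC (U _)) -!addrA.
exists (U i - U j :: xs); split; rewrite /= ?xs_size//.
  apply: fresh_cons => //; apply: freshS xsP => // x.
  rewrite inE mem_cat => /predU1P[->|->//]; apply/orP; right.
  by apply/allpairsP; exists (i, j).
by rewrite big_cons xsE; ring.
Qed.

Lemma solvable_small (D : set rat) (d : rat) (n : nat) : (2 <= n)%N ->
  p D -> p [set y | solvable_diff D n (d * y)].
Proof.
case: n => [//|[//|n]] _ pD; have pU := betaS_ultra p.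
have [//|pN] := in_ultra_setVsetC [set y | solvable_diff D n.+2 (d * y)] pU.
(* If the bad [y] formed a member of [p], it would contain all [U i - U j] for
   some [U]; but for some [j < i], [d * (U i - U j)] plus the sum [W i - W j] of
   fresh elements of [D] is a difference of two elements of [D]. *)
have /choice[Gf GfP] y : exists G, ~ solvable_diff D n.+2 (d * y) ->
    ~ exists z xs, [/\ size xs = n.+2, fresh D G (z :: xs)
    & \sum_(x <- xs) x + d * y = z].
  have [|/existsNP[G GP]] := pselect (solvable_diff D n.+2 (d * y)); first by exists [::].
  by exists G.
have [r rP] := returns_pigeonhole (p_ps pD).
have [U UP] := idempotent_intervals r p_idem (filterI pD pN).
pose idx := iota 0 r.+1.
(* These [n.+1] summands and one more from the return make up the [n.+2] values [x_j]. *)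
have [W WP] := idempotent_fresh_sums n r
  (flatten [seq Gf (U i - U j) | i <- idx, j <- idx]) (fun k => d * U k) pD.
exfalso; have [j i /WP[]//|j [i [ji]]] := rP (fun k => W k + d * U k).
have [_ [xs [xs_size xsP xsE]]] := WP j i ji; have [_ /= /GfP nsol] := UP j i ji.
move=> /returns_fresh/(_ xsP)[z [x [zP zE]]]; apply: nsol.
exists z, (x :: xs); split; rewrite /= ?xs_size//.
  apply: freshS zP => // g gG; apply/flattenP; exists (Gf (U i - U j)) => //.
  apply: (allpairs_f (fun i j => Gf (U i - U j))); rewrite mem_iota add0n ltnS.
    by case/andP: ji.
  by case/andP: ji => /ltnW; apply: leq_trans.
by rewrite big_cons xsE zE; ring.
Qed.

End Idempotent.

(** * Equations with many summands *)

Lemma finite_index_rat (H : set rat) (E : seq rat) :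
  (forall x y, H x -> H y -> H (x - y)) ->
  (forall q, exists2 e, e \in E & H (q + e)) -> H = setT.
Proof.
move=> HB HE; apply/seteqP; split=> // x _.
have H0 : H 0 by have [e _ He] := HE 0; rewrite -(subrr (0 + e)); apply: HB.
have HD a b : H a -> H b -> H (a + b).
  by move=> Ha Hb; rewrite -[b]opprK -[- b]add0r; exact/HB/HB.
have HMn a k : H a -> H (a *+ k).
  by move=> Ha; elim: k => [|k IH]; [rewrite mulr0n|rewrite mulrS; apply: HD].
(* [x] is a multiple of [(i - j) * y] when [0 < i - j <= r]. *)
pose r := size E; pose y : rat := x / (r`!)%:R.
have /choice[ef efP] k : exists e, e \in E /\ H (y *+ k + e).
  by have [e eE He] := HE (y *+ k); exists e.
have : ~~ uniq [seq ef k | k <- iota 0 r.+1].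
  apply/negP => /uniq_leq_size ef_size.
  have /ef_size : {subset [seq ef k | k <- iota 0 r.+1] <= E}.
    by move=> _ /mapP[k _ ->]; case: (efP k).
  by rewrite size_map size_iota ltnn.
move=> /(uniqPn 0)[j [i [ji]]]; rewrite size_map size_iota => ir.
rewrite !(nth_map 0%N) ?size_iota ?(ltn_trans ji)// !nth_iota ?(ltn_trans ji)//.
rewrite !add0n => efij.
have [_ Hj] := efP j; have [_ Hi] := efP i.
have := HB _ _ Hi Hj; rewrite efij opprD addrACA subrr addr0 -mulrnBr ?(ltnW ji)// => Hk.
have k_dvd : (i - j %| r`!)%N.
  apply: dvdn_fact; rewrite subn_gt0 ji /=; apply: leq_trans (leq_subr _ _) _.
  by rewrite -ltnS.
have := HMn _ (r`! %/ (i - j))%N Hk.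
rewrite -mulrnA mulnC divnK // -mulr_natr /y divfK //.
by rewrite pnatr_eq0 -lt0n fact_gt0.
Qed.

(** The sums of [m] fresh elements contain a translate of [L], with the same [t] for all of [L]. *)
Definition common_shift_sums (D : set rat) (m : nat) (L : set rat) :=
  forall G : seq rat, exists t, forall e, L e ->
    exists xs, [/\ size xs = m, fresh D G xs & \sum_(x <- xs) x = t + e].

Lemma common_shift_sumsS D m L L' :
  L `<=` L' -> common_shift_sums D m L' -> common_shift_sums D m L.
Proof. by move=> LL H G; have [t tP] := H G; exists t => e /LL/tP. Qed.

Lemma common_shift_sums_shift D m (L : set rat) c : common_shift_sums D m L ->
  common_shift_sums D m [set e | L (e + c)].
Proof.
move=> H G; have [t tP] := H G; exists (t + c) => e /tP[xs [xs_size xsP xsE]].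
by exists xs; split=> //; rewrite xsE addrA addrAC.
Qed.

(** The additional summand is [b] or [b + s], at choice. *)
Lemma common_shift_sums_returns D m (L : set rat) s : returns D s ->
  common_shift_sums D m L ->
  common_shift_sums D m.+1 (L `|` [set e | L (e - s)]).
Proof.
move=> [_ sP] H G; have [b [Db Dbs bG bsG]] := sP G.
have [t tP] := H (b :: b + s :: G); exists (b + t) => e.
case=> /tP[xs [xs_size xsP xsE]].
  exists (b :: xs); split; rewrite /= ?xs_size//; last by rewrite big_cons xsE addrA.
  apply: fresh_cons => //; apply: freshS xsP => // x.
  by rewrite !inE => /orP[]->; rewrite ?orbT.
exists (b + s :: xs); split; rewrite /= ?xs_size//; last first.
  by rewrite big_cons xsE; ring.
apply: fresh_cons => //; apply: freshS xsP => // x.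
by rewrite !inE => /orP[]->; rewrite ?orbT.
Qed.

(** The admissible [e] form a subgroup containing the syndetic set [returns D], hence all of the
    rationals. *)
Lemma common_shift_sums_rat (D : set rat) e m (L : set rat) :
  piecewise_syndetic D -> common_shift_sums D m L ->
  exists m', common_shift_sums D m' (L `|` [set x | L (x - e)]).
Proof.
move=> psD.
pose H : set rat := [set e | forall m L, common_shift_sums D m L ->
  exists m', common_shift_sums D m' (L `|` [set x | L (x - e)])].
suff HT : H = setT by have He : H e; [rewrite HT|apply: He].
have [E EP] := returns_syndetic psD.
apply: (@finite_index_rat _ E) => [x y Hx Hy k M MP|q]; last first.
  have [s sE ret] := EP q; exists s => // k M MP; exists k.+1.
  exact: common_shift_sums_returns.
(* Enlarging by [x], then by [y], and recentring by [y] gives the translate by [x - y]. *)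
have [k1 /Hy[k2 /(@common_shift_sums_shift _ _ _ y) k2P]] := Hx _ _ MP.
exists k2; apply: common_shift_sumsS k2P => z /= [Mz|Mz].
  by right; left; rewrite addrK.
by left; right; rewrite (_ : z + y - x = z - (x - y))//; ring.
Qed.

Lemma common_shift_sums_finite (D : set rat) (E : seq rat) :
  piecewise_syndetic D ->
  exists m, common_shift_sums D m [set e | e \in 0 :: E].
Proof.
move=> psD; elim: E => [|e E [m mP]].
  exists 0%N => G; exists 0 => e /=; rewrite inE => /eqP->.
  by exists [::]; split; rewrite ?big_nil ?addr0//; apply: fresh_nil.
have [m' m'P] := common_shift_sums_rat e psD mP.
exists m'; apply: common_shift_sumsS m'P => x /=.
rewrite !inE => /or3P[->|/eqP->|->]; [by left|right|left].
  by rewrite subrr eqxx.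
by rewrite orbT.
Qed.

(** Fresh sums of [n - 1] terms contain [t0 + E], and some [t0 + t + e] is a return [z - x]; this
    [x] is the last summand. *)
Lemma solvable_large (D : set rat) : piecewise_syndetic D ->
  exists N, forall n, (N <= n)%N -> solvable_diff D n = setT.
Proof.
move=> psD; have [E EP] := returns_syndetic psD.
have [s sP] := returns_neq0 psD.
have [m mP] := common_shift_sums_finite E psD.
have {}mP k : common_shift_sums D (k + m) [set e | e \in 0 :: E].
  elim: k => // k /(common_shift_sums_returns sP).
  by apply: common_shift_sumsS => e; left.
exists m.+1 => n mn; apply/seteqP; split=> // t _ G.
have nE : (n.-1 - m + m).+1 = n.
  by case: n mn => //= n; rewrite ltnS => /subnK->.
have [t0 t0P] := mP (n.-1 - m)%N G.
have [e eE ret] := EP (t0 + t).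
have [|xs [xs_size xsP xsE]] := t0P e; first by rewrite /= inE eE orbT.
have [z [x [zP zE]]] := returns_fresh ret xsP.
exists z, (x :: xs); split=> //; last by rewrite big_cons xsE zE; ring.
by rewrite /= xs_size nE.
Qed.

(** * Solving all equations injectively *)

Lemma star_system_injective_solution (d : nat -> rat) (C : set rat) (y : rat) :
  C y -> (forall n, (2 <= n)%N -> solvable_diff C n (d n * y)) ->
  exists f, [/\ star_system d f, forall v, C (f v) & injective f].
Proof.
move=> Cy sol.
have /choice[h hP] (nG : nat * seq rat) : exists s, (2 <= nG.1)%N ->
    [/\ size s = nG.1.+1, fresh C nG.2 s
      & \sum_(x <- behead s) x + d nG.1 * y = head 0 s].
  have [/sol/(_ nG.2)[z [xs [xs_size xsP xsE]]]|_] := leqP 2 nG.1.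
    by exists (z :: xs); rewrite /= xs_size.
  by exists [::].
(* [used n] holds [y] and all earlier blocks; for [n >= 2], block [n] is [z_n] followed by the
   [x_{n,j}]. *)
pose used := fix used n := if n is m.+1 then h (m, used m) ++ used m else [:: y].
pose block n := h (n, used n).
have used_le m n : (m <= n)%N -> {subset used m <= used n}.
  elim: n => [|n IH]; first by rewrite leqn0 => /eqP->.
  rewrite leq_eqVlt => /predU1P[->//|/IH mn x /mn xn].
  by rewrite /= mem_cat xn orbT.
have block_mem n k : (2 <= n)%N -> (k <= n)%N ->
    nth 0 (block n) k \in block n /\ C (nth 0 (block n) k) /\
    nth 0 (block n) k \notin used n.
  move=> n2 kn; have [sz [_ hC] _] := hP (n, used n) n2.
  by have nk : nth 0 (block n) k \in block n; [rewrite mem_nth ?sz|split=> //; apply: hC].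
have block_lt m n i j : (2 <= m)%N -> (i <= m)%N -> (2 <= n)%N -> (j <= n)%N ->
    (m < n)%N -> nth 0 (block m) i <> nth 0 (block n) j.
  move=> m2 im n2 jn mn eqij; have [_ [_ /negP]] := block_mem n j n2 jn; apply.
  rewrite -eqij; apply: (used_le m.+1) => //; rewrite /= mem_cat.
  by have [->] := block_mem m i m2 im.
have block_inj m n i j : (2 <= m)%N -> (i <= m)%N -> (2 <= n)%N -> (j <= n)%N ->
    nth 0 (block m) i = nth 0 (block n) j -> m = n /\ i = j.
  move=> m2 im n2 jn; have [mn|nm|mn] := ltngtP m n.
  - by move/block_lt; case.
  - by move/esym/block_lt; case.
  subst n; have [sz [uh _] _] := hP (m, used m) m2.
  by move=> /eqP; rewrite nth_uniq ?sz ?ltnS// => /eqP.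
have y_block n k : (2 <= n)%N -> (k <= n)%N -> y <> nth 0 (block n) k.
  move=> n2 kn yE; have [_ [_ /negP]] := block_mem n k n2 kn; apply.
  by rewrite -yE; apply: (used_le 0%N) => //; rewrite mem_head.
pose f v := match v with
  | Y1 => y
  | X n _ j => nth 0 (block n) j.+1
  | Z n _ => nth 0 (block n) 0
  end.
exists f; split.
- move=> n n2 /=; have [sz _] := hP (n, used n) n2; rewrite nth0 => <-.
  congr (_ + _); rewrite (big_nth 0) size_behead sz big_mkord.
  by apply: eq_bigr => j _; rewrite nth_behead.
- case=> [//|n n2 j|n n2] /=.
  + by have [_ []] := block_mem n j.+1 n2 (ltn_ord j).
  + by have [_ []] := block_mem n 0%N n2 isT.
case=> [|m m2 i|m m2] [|n n2 j|n n2] //= fE.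
- by have := y_block n _ n2 (ltn_ord j) fE.
- by have := y_block n 0%N n2 isT fE.
- by have := y_block m _ m2 (ltn_ord i) (esym fE).
- have [mn [ij]] := block_inj _ _ _ _ m2 (ltn_ord i) n2 (ltn_ord j) fE.
  by subst n; rewrite (bool_irrelevance m2 n2) (val_inj ij).
- by have [] := block_inj _ _ _ _ m2 (ltn_ord i) n2 (leq0n n) fE.
- by have := y_block m 0%N m2 isT (esym fE).
- by have [] := block_inj _ _ _ _ m2 (leq0n m) n2 (ltn_ord j) fE.
- have [mn _] := block_inj _ _ _ _ m2 (leq0n m) n2 (leq0n n) fE.
  by subst n; rewrite (bool_irrelevance m2 n2).
Qed.

Lemma star_system_strongly_central (d : nat -> rat) :
  strongly_centrally_partition_regular (star_system d).
Proof.
move=> C [p [Kp pp] pC]; have pU := betaS_ultra p.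
have p_ps A : p A -> piecewise_syndetic A by apply: beta_K_piecewise_syndetic.
have [N NP] := solvable_large (p_ps _ pC).
(* Finitely many [n] lie below [N], so the corresponding members of [p] can be intersected. *)
have : p [set y | forall n, (2 <= n < N)%N -> solvable_diff C n (d n * y)].
  elim: N {NP} => [|N IH]; first by apply: filterE => y n /andP[].
  have [N2|N2] := leqP 2 N; last first.
    apply: filterS IH => y yP n /andP[n2 nN]; apply: yP.
    by have := leq_ltn_trans n2 nN; rewrite ltnS leqNgt N2.
  apply: filterS2 IH (solvable_small p_ps pp (d N) N2 pC) => y yP yN n.
  by rewrite ltnS (leq_eqVlt n) => /andP[n2 /predU1P[->//|nN]]; apply: yP; rewrite n2.
move=> /(filterI pC)/filter_ex[y [Cy yP]].
apply: star_system_injective_solution Cy _ => n n2.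
by have [/NP->//|nN] := leqP N n; apply: yP; rewrite n2.
Qed.

(** * Integrality at a prime and failure over [GG F] *)

(** For a prime [q], the localisation of the integers at [q]. *)
Definition integral_at (q : nat) : set rat :=
  [set x | exists (a : int) (b : nat), ~~ (q %| b)%N /\ x * b%:R = a%:~R].

Lemma integral_atB q x y : prime q ->
  integral_at q x -> integral_at q y -> integral_at q (x - y).
Proof.
move=> q_prime [a [b [qb xE]]] [c [e [qe yE]]].
exists (a * e%:Z - c * b%:Z), (b * e)%N.
rewrite Euclid_dvdM // negb_or qb qe; split=> //.
by rewrite natrM rmorphB !rmorphM /= -xE -yE; ring.
Qed.

Lemma integral_at0 q : prime q -> integral_at q 0.
Proof. by move=> /prime_gt1; exists 0, 1%N; rewrite dvdn1 gtn_eqF ?mul0r. Qed.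

Lemma integral_atD q x y : prime q ->
  integral_at q x -> integral_at q y -> integral_at q (x + y).
Proof.
move=> q_prime qx qy; rewrite -[y]opprK -[- y]add0r.
by do !apply: integral_atB => //; apply: integral_at0.
Qed.

Lemma GG_integral_at (F : set nat) q : prime q -> ~ F q -> GG F `<=` integral_at q.
Proof.
move=> q_prime nFq _ [a [b [b_gt0 bF ->]]]; exists a, b; split.
  by apply/negP => /(bF _ q_prime).
by rewrite divfK // pnatr_eq0 -lt0n.
Qed.

(** Clearing denominators gives [a * e = c * M * b], where [p t ^ n] divides [M] and is coprime to
    [e]; it would divide [a], which is too small. *)
Lemma prime_power_coef_not_integral (p : nat -> nat) (t : nat) (y : rat) :
  (forall k, (0 < k)%N -> prime (p k)) -> (0 < t)%N -> y != 0 ->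
  integral_at (p t) y ->
  exists2 n, (2 <= n)%N & ~ integral_at (p t) (prime_power_coef p n * y).
Proof.
move=> p_prime t_gt0 y_neq0 [a [b [qb yE]]]; have q_prime := p_prime t t_gt0.
have a_neq0 : a != 0.
  apply: contra y_neq0 => /eqP a0; move/eqP: yE; rewrite a0 mulf_eq0.
  by case/orP => //; rewrite pnatr_eq0 => /eqP b0; rewrite b0 dvdn0 in qb.
(* The term [t] makes [p t] occur in the product, and the absolute value of [a] makes [p t ^ n]
   exceed it. *)
pose n := (2 + t + `|a|)%N; exists n; first by rewrite /n -addnA leq_addr.
move=> [c [e [qe dyE]]].
pose M := (\prod_(1 <= k < n.+1) p k ^ n)%N.
have q_dvd : (p t ^ n %| M)%N.
  have tn : t \in index_iota 1 n.+1.
    by rewrite mem_index_iota t_gt0 ltnS /n addnAC leq_addl.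
  by rewrite /M (big_rem t tn) dvdn_mulr.
have dM : prime_power_coef p n * M%:R = 1.
  rewrite natr_prod -big_split big_nat big1 // => k /andP[k_gt0 _] /=.
  by rewrite natrX mulVf // expf_neq0 // pnatr_eq0 -lt0n prime_gt0 // p_prime.
have : a%:~R * e%:R = c%:~R * (M * b)%:R :> rat.
  transitivity (prime_power_coef p n * M%:R * (y * b%:R * e%:R)).
    by rewrite dM mul1r yE.
  by rewrite -dyE natrM; ring.
rewrite !pmulrn -!rmorphM /= => /intr_inj.
move/(congr1 absz); rewrite !abszM !absz_nat => aE.
have : (p t ^ n %| `|a| * e)%N by rewrite aE dvdn_mull // dvdn_mulr.
rewrite Gauss_dvdl ?coprimeXl ?prime_coprime // => /dvdn_leq.
rewrite absz_gt0 a_neq0 => /(_ isT); apply/negP; rewrite -ltnNge.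
apply: leq_ltn_trans (ltn_expl _ (prime_gt1 q_prime)).
by rewrite /n leq_addl.
Qed.

Theorem theorem4p4 (p : nat -> nat) (p_enum : prime_enumeration p) :
  strongly_centrally_partition_regular (star_system (prime_power_coef p)) /\
  forall F : set nat, F `<` primes_set ->
    ~ partition_regular (star_system (prime_power_coef p)) (GG F).
Proof.
split=> [|F [_ /existsNP[q /not_implyP[q_prime nFq]]]]; first exact: star_system_strongly_central.
have [p_prime _ /(_ q q_prime)[t t_gt0 ptq]] := p_enum.
(* With one colour, partition regularity yields just a solution in nonzero elements of [GG F]. *)
move=> /(_ 1%N (fun=> ord0))[_ [f [f_sol _]]].
have f_int v : integral_at (p t) (val (f v)).
  rewrite ptq; apply: (GG_integral_at q_prime nFq).
  by have [] := set_valP (f v).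
have y_neq0 : val (f Y1) != 0 by have [_ /eqP] := set_valP (f Y1).
have pk_prime k : (0 < k)%N -> prime (p k) by apply: p_prime.
have q_pr := pk_prime t t_gt0.
have [n n2] := prime_power_coef_not_integral pk_prime t_gt0 y_neq0 (f_int Y1).
apply; have := f_sol n n2.
rewrite addrC => /(canRL (addrK _)) ->; apply: integral_atB => //.
elim/big_ind: _ => [|x x' |j _]; [exact: integral_at0|exact: integral_atD|exact: f_int].
Qed.
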